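(* Let $A$ be a real symmetric positive semidefinite $n\times n$ matrix that is completely positive. Then $\gamma_+(A)=\|A\|_{1,1}$.
   Context: A real positive semidefinite $n\times n$ matrix $A$ is completely positive if there exist $N\in\mathbb{N}$ and an entrywise nonnegative matrix $X\in\mathbb{R}_+^{n\times N}$ with $A=XX^*$. $\|A\|_{1,1}=\sum_{k,l=1}^n|A(k,l)|$, $\|x\|_1=\sum_i|x(i)|$, and $\gamma_+(A) := \inf\{\sum_{k=1}^N \|x_k\|_1^2 : N\in\mathbb{N},\ A = \sum_{k=1}^N x_kx_k^*\}$, where the $x_k$ are vectors in $\mathbb{R}^n$. *)

(* Defs.v *)
(* MathComp / MathComp-Analysis; the reals are an arbitrary R : realType. *)
From HB Require Import structures.
From mathcomp Require Import all_boot all_order all_algebra.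
From mathcomp Require Import classical_sets reals constructive_ereal ereal.
Set Implicit Arguments.
Unset Strict Implicit.
Unset Printing Implicit Defensive.
Import Order.TTheory GRing.Theory Num.Theory.
Local Open Scope classical_set_scope.
Local Open Scope ring_scope.

Definition possemidef (R : realType) (n : nat) (A : 'M[R]_n) : Prop :=
  A \is symmetricmx /\ forall x : 'cV[R]_n, 0 <= (x^T *m A *m x) 0 0.

(* Over the reals the conjugate transpose is the transpose. *)
Definition completely_positive (R : realType) (n : nat) (A : 'M[R]_n) : Prop :=
  possemidef A /\
  exists (N : nat) (X : 'M[R]_(n, N)),
    (forall i j, 0 <= X i j) /\ A = X *m X^T.

Definition norm11 (R : realType) (n : nat) (A : 'M[R]_n) : R :=
  \sum_(k < n) \sum_(l < n) `|A k l|.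

Definition norm1 (R : realType) (n : nat) (x : 'cV[R]_n) : R :=
  \sum_(i < n) `|x i 0|.

(* The infimum is taken in the extended reals, so that it is +oo (rather than
   a junk value) when A has no decomposition. The x_k may have entries of any
   sign. *)
Definition gamma_plus (R : realType) (n : nat) (A : 'M[R]_n) : \bar R :=
  ereal_inf [set g : \bar R | exists (N : nat) (x : 'I_N -> 'cV[R]_n),
    A = \sum_(k < N) x k *m (x k)^T /\
    g = (\sum_(k < N) norm1 (x k) ^+ 2)%:E].

(* Main.v *)
Require Import Defs.
From mathcomp Require Import all_boot all_order all_algebra.
From mathcomp Require Import reals constructive_ereal.
From mathcomp Require Import ereal.
Import Order.TTheory GRing.Theory Num.Theory.
Local Open Scope ring_scope.

(** Since [norm11 (x *m x^T) = norm1 x ^+ 2], the triangle inequality for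
    [norm11] bounds the cost of every decomposition below by [norm11 A]. The
    triangle inequality is an equality for entrywise nonnegative summands, so
    the columns of a nonnegative factor of [A] attain the bound. *)

(** Each entry has modulus [|x_k| |x_l|], so the double sum factors. *)
Lemma norm11_outer (R : realType) (n : nat) (x : 'cV[R]_n) :
  norm11 (x *m x^T) = norm1 x ^+ 2.
Proof.
rewrite /norm11 /norm1 expr2 mulr_suml; apply: eq_bigr => k _.
rewrite mulr_sumr; apply: eq_bigr => l _.
by rewrite !mxE big_ord1 mxE normrM.
Qed.

Lemma ler_norm11_sum (R : realType) (n N : nat) (B : 'I_N -> 'M[R]_n) :
  norm11 (\sum_(m < N) B m) <= \sum_(m < N) norm11 (B m).
Proof.
(* Two exchanges move the sum over [m] innermost, leaving the scalar triangle inequality at each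
   entry. *)
rewrite /norm11 [leRHS]exchange_big; apply: ler_sum => k _.
rewrite [leRHS]exchange_big; apply: ler_sum => l _.
by rewrite summxE; apply: ler_norm_sum.
Qed.

Lemma norm11_sum_ge0 (R : realType) (n N : nat) (B : 'I_N -> 'M[R]_n) :
  (forall m k l, 0 <= B m k l) ->
  norm11 (\sum_(m < N) B m) = \sum_(m < N) norm11 (B m).
Proof.
move=> B_ge0; rewrite /norm11 [RHS]exchange_big; apply: eq_bigr => k _.
rewrite [RHS]exchange_big; apply: eq_bigr => l _.
rewrite summxE ger0_norm ?sumr_ge0//.
by apply: eq_bigr => m _; rewrite ger0_norm.
Qed.

(** Turns a factorization into a decomposition of the kind that [gamma_plus] ranges over. *)
Lemma mulmx_tr_sum_col (R : realType) (n N : nat) (X : 'M[R]_(n, N)) :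
  X *m X^T = \sum_(m < N) col m X *m (col m X)^T.
Proof.
apply/matrixP => k l; rewrite summxE mxE; apply: eq_bigr => m _.
by rewrite !mxE big_ord1 !mxE.
Qed.

Theorem proposition2p10 (R : realType) (n : nat) (A : 'M[R]_n)
    (psdA : possemidef A) (cpA : completely_positive A) :
  gamma_plus A = (norm11 A)%:E.
Proof.
case: cpA => _ [N [X [X_ge0 AX]]].
apply/eqP; rewrite eq_le; apply/andP; split.
- apply: ereal_inf_lbound; exists N, (fun m => col m X).
  split; first by rewrite AX mulmx_tr_sum_col.
  congr (_%:E); rewrite AX mulmx_tr_sum_col norm11_sum_ge0.
    by apply: eq_bigr => m _; rewrite norm11_outer.
  by move=> m k l; rewrite !mxE big_ord1 !mxE mulr_ge0.
(* Lower bound: the vectors [x] are arbitrary here, with entries of any sign. *)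
- apply: le_ereal_inf_tmp => _ [M [x [-> ->]]].
  rewrite lee_fin (le_trans (ler_norm11_sum _ _ _ _))//.
  by apply: ler_sum => m _; rewrite norm11_outer.
Qed.
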